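(* Let $G$ be a finite group. Then the following are equivalent: (i) $\mathcal I(G)$ is totally disconnected; (ii) every proper subgroup of $G$ has prime order; (iii) the height of $L(G)$ is $2$.
   Context: For a finite group $G$, the inclusion graph of subgroups $\mathcal I(G)$ is the simple graph whose vertices are the proper subgroups of $G$, where ''proper'' means different from both the trivial subgroup and $G$ itself; two distinct vertices $H,K$ are adjacent if and only if $H\subset K$ or $K\subset H$. Graphs are understood to have a nonempty vertex set, so $G$ is assumed to have at least one subgroup different from $\{e\}$ and $G$. A graph is totally disconnected if it has no edges. $L(G)$ is the subgroup lattice of $G$ (all subgroups, including $\{e\}$ and $G$), and its height is the length (number of strict inclusions) of a longest chain of subgroups from $G$ to $\{e\}$. *)

(* Defs.v *)
From HB Require Import structures.
From mathcomp Require Import all_boot all_fingroup.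

Set Implicit Arguments.
Unset Strict Implicit.
Unset Printing Implicit Defensive.

Local Open Scope group_scope.

Record sgraph : Type := SGraph {
  vertex :> finType;
  adj : rel vertex;
  adj_sym : symmetric adj;
  adj_irrefl : irreflexive adj }.

Definition totally_disconnected (X : sgraph) : Prop :=
  forall x y : X, ~~ adj x y.

(* "Proper" excludes the trivial subgroup as well as G, unlike \proper. *)
Definition proper_subgroup (gT : finGroupType) (G H : {group gT}) : bool :=
  [&& H \subset G, H :!=: 1 & H :!=: G].

Section InclusionGraph.

Variables (gT : finGroupType) (G : {group gT}).

Definition inclusion_vertex : finType :=
  {H : {group gT} | proper_subgroup G H}.

Definition inclusion_adj : rel inclusion_vertex := fun H K =>
  (H != K) && ((val H \subset val K) || (val K \subset val H)).

Lemma inclusion_adj_sym : symmetric inclusion_adj.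
Proof. by move=> H K; rewrite /inclusion_adj eq_sym orbC. Qed.

Lemma inclusion_adj_irrefl : irreflexive inclusion_adj.
Proof. by move=> H; rewrite /inclusion_adj eqxx. Qed.

Definition inclusion_graph : sgraph :=
  SGraph inclusion_adj_sym inclusion_adj_irrefl.

End InclusionGraph.

Section Height.

Variables (gT : finGroupType) (G : {group gT}).

(* G :: s is strictly decreasing and ends at the trivial subgroup, so that
   size s is its number of strict inclusions. *)
Definition subgroup_chain (s : seq {group gT}) : bool :=
  path (fun H K : {group gT} => K \proper H) G s && (last G s :==: 1).

(* The bound on n loses no chain, since the n.+1 members of a chain with n
   strict inclusions are distinct subgroups of G; see leq_lattice_height. *)
Definition lattice_height : nat :=
  \max_(n < #|subgroups G| | [exists s : n.-tuple {group gT}, subgroup_chain s])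
    n.

Lemma subgroup_chain_size s : subgroup_chain s -> size s < #|subgroups G|.
Proof.
case/andP=> sP _.
have trP : transitive (fun H K : {group gT} => K \proper H).
  by move=> H K L HK LH; apply: proper_trans LH HK.
have Us : uniq (G :: s).
  by apply: (@sorted_uniq _ _ trP _ (G :: s) sP) => H; apply: properxx.
rewrite -[(size s).+1]/(size (G :: s)) -(card_uniqP Us).
apply/subset_leq_card/subsetP=> H; rewrite inE => /predU1P[->|Hs].
  by rewrite inE.
by rewrite inE; apply: proper_sub; apply: (allP (order_path_min trP sP)).
Qed.

Lemma leq_lattice_height s : subgroup_chain s -> size s <= lattice_height.
Proof.
move=> sC; pose n := Ordinal (subgroup_chain_size sC).
apply: (@leq_bigmax_cond _ _ (fun i : 'I__ => nat_of_ord i) n).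
by apply/existsP; exists (in_tuple s).
Qed.

Lemma lattice_height_attained :
  exists2 s, subgroup_chain s & size s = lattice_height.
Proof.
have [s0 s0C] : exists s, subgroup_chain s.
  have [G1|nG1] := eqVneq (G : {set gT}) 1.
    by exists [::]; rewrite /subgroup_chain /= G1.
  exists [:: 1%G]; rewrite /subgroup_chain /= andbT eqxx andbT.
  by rewrite properEneq eq_sym nG1 sub1G.
have : 0 < #|[pred n : 'I_#|subgroups G| |
    [exists s : n.-tuple {group gT}, subgroup_chain s]]|.
  apply/card_gt0P; exists (Ordinal (subgroup_chain_size s0C)).
  by apply/existsP; exists (in_tuple s0).
case/(eq_bigmax_cond (fun i : 'I__ => nat_of_ord i))=> n /existsP[s sC] En.
by exists s; rewrite // size_tuple -En.
Qed.

End Height.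

(* Main.v *)
Require Import Defs.
From mathcomp Require Import all_boot all_fingroup.
From mathcomp Require Import pgroup.

(** All three conditions say that the proper subgroups of G form an antichain,
    which is how they are compared. For the inclusion graph this is the
    absence of edges ([totally_disconnectedP]).

    A proper subgroup H in an antichain is minimal, and by Cauchy's theorem it
    contains a subgroup of prime order; the latter is again proper in G, so it
    is H. Conversely, by Lagrange's theorem, a group of prime order contains no
    nontrivial subgroup other than itself. This gives [antichain_primeP].

    For the height, a proper subgroup H always yields the chain G > H > 1 of
    length 2. In a longer chain the two terms right below G are nested distinct
    proper subgroups, and nested distinct proper subgroups H < K conversely give
    the chain G > K > H > 1. This gives [antichain_heightP], the existence of a
    proper subgroup supplying the other inequality. *)

Section Antichain.

Variables (gT : finGroupType) (G : {group gT}).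
Implicit Types H K : {group gT}.

Definition proper_subgroups_antichain : Prop :=
  forall H K, proper_subgroup G H -> proper_subgroup G K ->
    H \subset K -> H = K.

Lemma proper_subgroup_sub H K :
  proper_subgroup G K -> H \subset K -> H :!=: 1%g -> proper_subgroup G H.
Proof.
case/and3P=> sKG _ nKG sHK ntH; apply/and3P; split=> //.
  exact: subset_trans sHK sKG.
apply: contraNneq nKG => eHG.
by rewrite eqEsubset sKG -eHG.
Qed.

Lemma totally_disconnectedP :
  totally_disconnected (inclusion_graph G) <-> proper_subgroups_antichain.
Proof.
split=> [dG H K pH pK sHK | aG [H pH] [K pK]].
  have := dG (exist _ H pH) (exist _ K pK).
  by rewrite /= /inclusion_adj /= sHK andbT negbK => /eqP [].
apply/negP => /andP[/= /eqP neHK /orP[sHK | sKH]]; apply: neHK.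
  by apply: val_inj; apply: aG.
by apply: val_inj; apply/esym/aG.
Qed.

Lemma antichain_primeP :
  proper_subgroups_antichain <->
  (forall H, proper_subgroup G H -> prime #|H|).
Proof.
split=> [aG H pH | prG H K /and3P[_ ntH _] pK sHK].
  have /and3P[_ ntH _] := pH.
  have pr_p : prime (pdiv #|H|) by rewrite pdiv_prime // cardG_gt1.
  have [x Hx ox] := Cauchy pr_p (pdiv_dvd _).
  have sxH : <[x]>%G \subset H by rewrite /= cycle_subG.
  have px : proper_subgroup G <[x]>%G.
    apply: proper_subgroup_sub pH sxH _.
    by rewrite -cardG_gt1 -[#|_|]/#[x]%g ox prime_gt1.
  by rewrite -(aG _ _ px pH sxH) -[#|_|]/#[x]%g ox.
apply/val_inj/eqP; rewrite /= eqEcard sHK /=.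
have /primeP[_ dvK] := prG K pK.
have /orP[] := dvK _ (cardSg sHK); last by move/eqP->.
by rewrite -trivg_card1 (negPf ntH).
Qed.

Lemma lattice_height_ge2 H : proper_subgroup G H -> 2 <= lattice_height G.
Proof.
case/and3P=> sHG ntH nHG; apply: (@leq_lattice_height _ _ [:: H; 1%G]).
by rewrite /subgroup_chain /= !properEneq nHG sHG eq_sym ntH sub1G eqxx.
Qed.

Lemma antichain_heightP :
  proper_subgroups_antichain <-> lattice_height G <= 2.
Proof.
split=> [aG | hG H K /and3P[_ ntH _] /and3P[sKG _ nKG] sHK].
  have [s sC <-] := lattice_height_attained G.
  case: s sC => [|K [|H [|L s]]] //= /andP[/and4P[pKG pHK pLH _] _].
  have pK : proper_subgroup G K.
    apply/and3P; split; first exact: proper_sub.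
      by rewrite -proper1G (sub_proper_trans (sub1G H)).
    by rewrite proper_neq.
  have pH : proper_subgroup G H.
    apply: proper_subgroup_sub pK (proper_sub pHK) _.
    by rewrite -proper1G (sub_proper_trans (sub1G L)).
  by move: (pHK); rewrite (aG H K pH pK (proper_sub pHK)) properxx.
apply/val_inj/eqP/negP => /= /negP neHK.
have : subgroup_chain G [:: K; H; 1%G].
  rewrite /subgroup_chain /= !properEneq nKG sKG neHK sHK.
  by rewrite eq_sym ntH sub1G eqxx.
by move/leq_lattice_height/leq_trans/(_ hG).
Qed.

End Antichain.

Theorem theorem2p6 (gT : finGroupType) (G : {group gT})
    (hG : exists H : {group gT}, proper_subgroup G H) :
  (totally_disconnected (inclusion_graph G) <->
     (forall H : {group gT}, proper_subgroup G H -> prime #|H|)) /\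
  ((forall H : {group gT}, proper_subgroup G H -> prime #|H|) <->
     lattice_height G = 2).
Proof.
split; first exact: iff_trans (totally_disconnectedP _ _) (antichain_primeP _ _).
apply: iff_trans (iff_sym (antichain_primeP _ _)) _.
apply: iff_trans (antichain_heightP _ _) _.
have [H /lattice_height_ge2 h2] := hG.
split=> [hle | ->] //.
by apply/eqP; rewrite eqn_leq hle.
Qed.
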